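(* Let $S$ be an $F_\sigma$ Acyclic digraph on $2^\omega$ containing $\mathbb{G}_0$. Then there is an injective continuous $f:2^\omega\to2^\omega$ such that $\mathbb{G}_0\subseteq(f\times f)^{-1}(\mathbb{G}_0)\subseteq(f\times f)^{-1}(S)\subseteq s(\mathbb{G}_0)$.
   Context: A digraph is an irreflexive relation. For a relation $A$, $s(A):=A\cup A^{-1}$; $A$ is Acyclic if $s(A)$ is acyclic, i.e. there is no injective sequence $(x_i)_{i\le n}$, $n\ge2$, with $(x_i,x_{i+1})\in s(A)$ for $i<n$ and $(x_n,x_0)\in s(A)$. Let $\psi:\omega\to2^{<\omega}$ list finite binary sequences by increasing length and lexicographically within each length, $s_n:=\psi(n)0^{n-|\psi(n)|}$, and $\mathbb{G}_0:=\{(s_n0\gamma,s_n1\gamma)\mid n\in\omega,\gamma\in2^\omega\}$. *)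

(* Defs.v *)
From mathcomp Require Import all_boot.
From mathcomp Require Import all_classical all_reals all_analysis.

Set Implicit Arguments.
Unset Strict Implicit.
Unset Printing Implicit Defensive.

Local Open Scope classical_set_scope.
Local Open Scope relation_scope.

Definition digraph (T : Type) (A : set (T * T)) : Prop :=
  forall x : T, ~ A (x, x).

Definition symcl (T : Type) (A : set (T * T)) : set (T * T) := A `|` A^-1.

(* Only the values x 0, ..., x n of the sequence x matter. *)
Definition acyclic (T : Type) (E : set (T * T)) : Prop :=
  ~ exists n : nat, exists x : nat -> T,
      [/\ (2 <= n)%N,
          (forall i j, (i <= n)%N -> (j <= n)%N -> x i = x j -> i = j),
          (forall i, (i < n)%N -> E (x i, x i.+1))
        & E (x n, x 0%N)].

Definition Acyclic (T : Type) (A : set (T * T)) : Prop := acyclic (symcl A).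

(* The binary words of length l, in lexicographic order. *)
Fixpoint words (l : nat) : seq (seq bool) :=
  if l is l'.+1 then
    [seq false :: w | w <- words l'] ++ [seq true :: w | w <- words l']
  else [:: [::]].

(* There are 2 ^ n.+1 - 1 > n words of length at most n, so the default value
   of nth is never used. *)
Definition psi (n : nat) : seq bool :=
  nth [::] (flatten [seq words l | l <- iota 0 n.+1]) n.

Definition sn (n : nat) : seq bool :=
  psi n ++ nseq (n - size (psi n)) false.

Definition catw (w : seq bool) (gamma : cantor_space) : cantor_space :=
  fun i => if (i < size w)%N then nth false w i else gamma (i - size w)%N.

Definition G0 : set (cantor_space * cantor_space) :=
  [set xy | exists n : nat, exists gamma : cantor_space,
     xy = (catw (rcons (sn n) false) gamma, catw (rcons (sn n) true) gamma)].

Definition prodmap (T U : Type) (f : T -> U) (xy : T * T) : U * U :=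
  (f xy.1, f xy.2).

Lemma size_words l : size (words l) = (2 ^ l)%N.
Proof.
by elim: l => //= l IH; rewrite size_cat !size_map IH expnS mul2n addnn.
Qed.

Lemma mem_words l w : (w \in words l) = (size w == l).
Proof.
elim: l w => [|l IH] [|b w] //=; rewrite mem_cat.
  by apply/negbTE; rewrite negb_or; apply/andP; split; apply/mapP => -[].
rewrite eqSS -IH; apply/orP/idP.
  by case=> /mapP[v vl [_ ->]].
by case: b => wl; [right|left]; apply/mapP; exists w.
Qed.

Lemma size_flatten_words n :
  (n < size (flatten [seq words l | l <- iota 0 n.+1]))%N.
Proof.
elim: n => // n IH.
rewrite -(addn1 n.+1) iotaD map_cat flatten_cat size_cat add0n.
rewrite [flatten (map _ (iota n.+1 1))]cats0 size_words.
by apply: leq_add IH _; rewrite expn_gt0.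
Qed.

Lemma size_psi n : (size (psi n) <= n)%N.
Proof.
have /(mem_nth [::])/flattenP[s /mapP[l]] := size_flatten_words n.
by rewrite mem_iota add0n ltnS => /andP[_ ln] ->; rewrite mem_words => /eqP ->.
Qed.

Lemma size_sn n : size (sn n) = n.
Proof. by rewrite size_cat size_nseq subnKC// size_psi. Qed.

(* Main.v *)
(** The map [f] spreads the bits of [x] over positions [m 0 < m 1 < ...] and
    puts [false] elsewhere. The positions are chosen recursively so that the
    word [f (s_n 0^oo)] cut at length [m n] is [s_(m n)], which makes [f] a
    homomorphism of [G0]. If [x] and [y] differ at finitely many places, they
    are joined by a path of [s(G0)], which [f] maps into [s(S)]; by acyclicity
    [(f x, f y)] can only be in [S] when [x = y] or [(x, y)] is in [s(G0)], and
    [x = y] is excluded since [S] is a digraph. In particular, for finite words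
    [u], [v] differing at two places, [(f (u 0^oo), f (v 0^oo))] is not in the
    closed pieces [F_k] of [S], and neither are nearby points: choosing [m n]
    large enough to ensure this for all [u], [v] of length [n] and [k <= n]
    takes care of the pairs that differ at infinitely many places. *)
Require Import Defs.
From mathcomp Require Import all_boot.
From mathcomp Require Import all_classical all_reals all_analysis.
From mathcomp Require Import borel_hierarchy.

Local Open Scope classical_set_scope.

(** * Density of the words [sn n] *)

Lemma psi_surj (w : seq bool) : exists n, psi n = w.
Proof.
pose F N := flatten [seq words l | l <- iota 0 N].
have Fprefix N k i : (i < size (F N))%N ->
    nth [::] (F (N + k)%N) i = nth [::] (F N) i.
  by move=> iN; rewrite /F iotaD map_cat flatten_cat nth_cat iN.
have wF : w \in F (size w).+1.
  apply/flattenP; exists (words (size w)); last by rewrite mem_words.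
  by apply: map_f; rewrite mem_iota add0n ltnS leqnn.
exists (index w (F (size w).+1)).
rewrite /psi -/(F _); set j := index _ _.
have jF : (j < size (F (size w).+1))%N by rewrite index_mem.
have jF' : (j < size (F j.+1))%N by exact: size_flatten_words.
(* Either list may be the longer one, so both are compared with a common extension, of which each is
   a prefix. *)
rewrite -(Fprefix _ (size w).+1 _ jF') addnC Fprefix //.
exact: nth_index.
Qed.

Lemma sn_dense (w : seq bool) : exists2 M, (size w <= M)%N &
  forall i, nth false (sn M) i = nth false w i.
Proof.
have [M Mw] := psi_surj w; exists M; first by rewrite -Mw size_psi.
move=> i; rewrite /sn Mw nth_cat; case: ltnP => // wi.
by rewrite nth_nseq if_same nth_default.
Qed.

(** * Convergence and closed sets in the Cantor space *)

Lemma cantor_cvg (T : Type) (F : set_system T) (FF : Filter F)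
    (u : T -> cantor_space) (l : cantor_space) :
  (forall i, \forall t \near F, u t i = l i) -> u @ F --> l.
Proof.
move=> ul; apply/(@pointwise_cvgP nat bool (u @ F) l) => i.
exact: (@cvg_near_cst T bool (l i) (fun t => u t i) F FF (ul i)).
Qed.

Lemma cantor_near (x : cantor_space) (i : nat) : \forall y \near x, y i = x i.
Proof.
have /(@pointwise_cvgP nat bool (nbhs x) x) /(_ i) : nbhs x --> x.
  exact: cvg_id.
by move=> /(_ [set x i]); apply; exact: discrete_set1.
Qed.

(** Otherwise points of [F] picked in smaller and smaller cylinders would converge to [(a, b)]. *)
Lemma closed_cylinder (F : set (cantor_space * cantor_space)) a b :
  closed F -> ~ F (a, b) -> exists K, forall a' b',
    (forall i, (i < K)%N -> a' i = a i) ->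
    (forall i, (i < K)%N -> b' i = b i) -> ~ F (a', b').
Proof.
move=> cF nF; apply: contrapT => /forallNP noK; apply: nF.
have /choice[u uP] : forall K, exists ab : cantor_space * cantor_space,
    [/\ forall i, (i < K)%N -> ab.1 i = a i,
        forall i, (i < K)%N -> ab.2 i = b i & F ab].
  move=> K; apply: contrapT => /forallNP nab; apply: (noK K) => a' b' aa bb Fab.
  by apply: (nab (a', b')).
apply: (@closed_cvg _ _ \oo _ u F cF) => //.
  by apply: nearW => K; case: (uP K).
rewrite [u](_ : _ = fun K => ((u K).1, (u K).2)); last first.
  by apply/funext => K; case: (u K).
apply: (@cvg_pair _ _ _ \oo (nbhs a) (nbhs b)); apply: cantor_cvg => i;
  by exists i.+1 => // K /= iK; case: (uP K) => ? ? _; auto.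
Qed.

(** * Spreading bits, and the recursive choice of the positions *)

Definition trunc (n : nat) (x : cantor_space) : cantor_space :=
  fun i => (i < n)%N && x i.

(** The existential makes sense for any [m], so it applies while only finitely many positions are
    fixed. *)
Definition spread (m : nat -> nat) (x : cantor_space) : cantor_space :=
  fun i => `[< exists2 j, m j = i & x j >].

Lemma eq_spread m m' (x x' : cantor_space) i :
  (forall j, m j = i -> x j -> m' j = i /\ x' j) ->
  (forall j, m' j = i -> x' j -> m j = i /\ x j) ->
  spread m x i = spread m' x' i.
Proof.
by move=> h h'; apply: asbool_equiv_eq; split=> -[j mj xj]; exists j;
  [case: (h j mj xj)|case: (h j mj xj)|case: (h' j mj xj)|case: (h' j mj xj)].
Qed.

Lemma eq_spreadr m (x x' : cantor_space) i :
  (forall j, m j = i -> x j = x' j) -> spread m x i = spread m x' i.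
Proof. by move=> h; apply: eq_spread => j mj; rewrite h. Qed.

Lemma eq_spreadl m m' n x : (forall j, (j < n)%N -> m j = m' j) ->
  spread m (trunc n x) = spread m' (trunc n x).
Proof.
move=> h; apply/funext => i.
by apply: eq_spread => j mj /andP[jn xj]; split; rewrite /trunc ?jn// -mj h.
Qed.

Lemma trunc_catw w :
  trunc (size w) (catw w (fun=> false)) = catw w (fun=> false).
Proof. by apply/funext => i; rewrite /trunc /catw; case: ltnP. Qed.

Lemma fin_bound (I : finType) (P : I -> nat -> Prop) :
  (forall i K L, (K <= L)%N -> P i K -> P i L) ->
  (forall i, exists K, P i K) -> exists K, forall i, P i K.
Proof.
move=> mono /choice[K KP]; exists (\max_i K i)%N => i.
exact: mono (leq_bigmax i) (KP i).
Qed.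

(** What [M] must satisfy to serve as [m n]; only the values of [m] below [n] matter. Truncated
    points stand for finite words followed by zeros. *)
Definition good_next (F : nat -> set (cantor_space * cantor_space))
    (m : nat -> nat) (n M : nat) : Prop :=
  [/\ forall j, (j < n)%N -> (m j < M)%N,
      forall i, (i < M)%N ->
        nth false (sn M) i = spread m (catw (sn n) (fun=> false)) i
    & forall k x y (a b : cantor_space), (k <= n)%N ->
        ~ F k (spread m (trunc n x), spread m (trunc n y)) ->
        (forall i, (i < M)%N -> a i = spread m (trunc n x) i) ->
        (forall i, (i < M)%N -> b i = spread m (trunc n y) i) -> ~ F k (a, b)].

Lemma good_next_local F m m' n M : (forall j, (j < n)%N -> m j = m' j) ->
  good_next F m n M -> good_next F m' n M.
Proof.
move=> mm' [h1 h2 h3]; split.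
- by move=> j jn; rewrite -mm' // h1.
- move=> i iM; rewrite h2 // -trunc_catw size_sn.
  by rewrite (eq_spreadl _ _ _ _ mm').
- move=> k x y a b kn; rewrite -!(eq_spreadl _ _ _ _ mm'); exact: h3.
Qed.

(** Truncations at [n] come from finitely many tuples, so one bound [K] serves all of them and all
    [k <= n]; density of the [sn M] then gives [M >= K]. *)
Lemma good_next_exists F m n : (forall k, closed (F k)) ->
  exists M, good_next F m n M.
Proof.
move=> cF.
have [K1 K1P] : exists K, forall j : 'I_n, (m j < K)%N.
  apply: (fin_bound 'I_n (fun j K => m j < K)%N) => [i K L KL|i].
    by move/leq_trans; apply.
  by exists (m i).+1.
pose ext (t : n.-tuple bool) : cantor_space := fun i => nth false t i.
pose avoids (t : n.-tuple bool * n.-tuple bool * 'I_n.+1) (K : nat) :=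
    ~ F t.2 (spread m (trunc n (ext t.1.1)), spread m (trunc n (ext t.1.2))) ->
    forall a b : cantor_space,
    (forall i, (i < K)%N -> a i = spread m (trunc n (ext t.1.1)) i) ->
    (forall i, (i < K)%N -> b i = spread m (trunc n (ext t.1.2)) i) ->
    ~ F t.2 (a, b).
have [K2 K2P] : exists K, forall t, avoids t K.
  apply: fin_bound => [t K L KL h /h {}h a b ha hb|t].
    by apply: h => i iK; [apply: ha|apply: hb]; exact: leq_trans KL.
  have [Ft|nFt] := pselect (F t.2
      (spread m (trunc n (ext t.1.1)), spread m (trunc n (ext t.1.2)))).
    by exists 0%N.
  by have [K KP] := closed_cylinder _ _ _ (cF _) nFt; exists K => _; exact: KP.
pose K := maxn K1 K2.
have [M KM snM] := sn_dense
  (mkseq (spread m (catw (sn n) (fun=> false))) K).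
rewrite size_mkseq in KM.
have K1M : (K1 <= M)%N by exact: leq_trans (leq_maxl _ _) KM.
have K2M : (K2 <= M)%N by exact: leq_trans (leq_maxr _ _) KM.
exists M; split.
- by move=> j jn; exact: leq_trans (K1P (Ordinal jn)) K1M.
- move=> i iM; rewrite snM; have [iK|Ki] := ltnP i K.
    by rewrite nth_mkseq.
  (* From [K] on both sides are zero: the bits of [sn n] have index below [n] and land below
     [K1]. *)
  rewrite nth_default ?size_mkseq //; apply/esym/asboolPn => -[j mj].
  rewrite /catw size_sn; case: ltnP => // jn _.
  move: Ki; rewrite -mj leqNgt => /negP; apply.
  exact: leq_trans (K1P (Ordinal jn)) (leq_maxl _ _).
- have truncE x : trunc n x = trunc n (ext (mktuple (fun i : 'I_n => x i))).
    apply/funext => i; rewrite /trunc; case: ltnP => //= ilt.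
    by rewrite /ext -[i]/(nat_of_ord (Ordinal ilt)) -tnth_nth tnth_mktuple.
  move=> k x y a b; rewrite -ltnS => kn; rewrite (truncE x) (truncE y).
  move=> /(K2P (_, _, Ordinal kn)) h ha hb.
  by apply: h => i iK; [apply: ha|apply: hb]; exact: leq_trans K2M.
Qed.

Lemma course_of_values_choice (P : (nat -> nat) -> nat -> nat -> Prop) :
  (forall m m' n M,
    (forall j, (j < n)%N -> m j = m' j) -> P m n M -> P m' n M) ->
  (forall m n, exists M, P m n M) -> exists m, forall n, P m n (m n).
Proof.
move=> Ploc Pex.
have /choice[next nextP] :
    forall mn : (nat -> nat) * nat, exists M, P mn.1 mn.2 M.
  by move=> mn; exact: Pex.
(* [L n] lists the first [n] values; the default [0] read beyond them is harmless by locality of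
   [P]. *)
pose L := fix L n := if n is n'.+1 then
  rcons (L n') (next (nth 0%N (L n'), n')) else [::].
pose m n := next (nth 0%N (L n), n).
have sizeL n : size (L n) = n by elim: n => //= n IH; rewrite size_rcons IH.
have nthL n j : (j < n)%N -> nth 0%N (L n) j = m j.
  elim: n => // n IH; rewrite ltnS leq_eqVlt => /orP[/eqP->|jn] /=.
    by rewrite nth_rcons sizeL ltnn eqxx.
  by rewrite nth_rcons sizeL jn IH.
by exists m => n; apply: Ploc (nextP (nth 0%N (L n), n)) => j; exact: nthL.
Qed.

(** * Injectivity, continuity and the homomorphism property *)

Lemma spread_at m x j : injective m -> spread m x (m j) = x j.
Proof.
move=> m_inj; apply/idP/idP => [/asboolP[i /m_inj-> //]|xj].
by apply/asboolP; exists j.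
Qed.

Lemma spread_inj m : injective m -> injective (spread m).
Proof.
move=> m_inj x y xy; apply/funext => j.
by rewrite -(spread_at m x j m_inj) xy spread_at.
Qed.

Lemma spread_continuous m : injective m -> continuous (spread m).
Proof.
move=> m_inj x; apply: cantor_cvg => i.
have [[j mj]|nj] := pselect (exists j, m j = i).
  by rewrite -mj; near=> y; rewrite !spread_at //; near: y; exact: cantor_near.
by apply: nearW => y; apply: eq_spreadr => j mj; case: nj; exists j.
Unshelve. all: by end_near. Qed.

Lemma spread_trunc m x n i : {homo m : i j / (i < j)%N} -> (i < m n)%N ->
  spread m x i = spread m (trunc n x) i.
Proof.
move=> /leq_mono/leqW_mono m_lt imn; apply: eq_spreadr => j mj.
by rewrite /trunc -m_lt mj imn.
Qed.

Lemma spread_G0 m : {homo m : i j / (i < j)%N} ->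
  (forall n i, (i < m n)%N ->
    nth false (sn (m n)) i = spread m (catw (sn n) (fun=> false)) i) ->
  G0 `<=` prodmap (spread m) @^-1` G0.
Proof.
move=> m_homo sn_m _ [n [gamma ->]].
have m_inj := incn_inj (leq_mono m_homo).
pose x e := catw (rcons (sn n) e) gamma.
have xE e i : x e i = if (i < n)%N then nth false (sn n) i else
    if i == n then e else gamma (i - n.+1)%N.
  rewrite /x /catw size_rcons size_sn nth_rcons size_sn ltnS leq_eqVlt.
  by case: ltngtP.
(* The tail is the same for [x true], which differs from [x false] only at [n], a bit sent to
   [m n]. *)
pose delta : cantor_space := fun i => spread m (x false) (i + (m n).+1)%N.
suff main e : spread m (x e) = catw (rcons (sn (m n)) e) delta.
  by exists (m n), delta; rewrite /prodmap /= -!main.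
apply/funext => i; rewrite /catw size_rcons size_sn nth_rcons size_sn ltnS.
case: (ltngtP i (m n)) => [imn|mni|->].
- rewrite sn_m // (spread_trunc _ _ n) // [RHS](spread_trunc _ _ n) //.
  apply: eq_spreadr => j _.
  by rewrite /trunc xE /catw size_sn; case: ltnP.
- rewrite /delta subnK //; apply: eq_spreadr => j mj.
  have nj : (n < j)%N by rewrite -(leqW_mono (leq_mono m_homo)) mj.
  by rewrite !xE ltnNge (ltnW nj) /= gtn_eqF.
- by rewrite (spread_at _ _ _ m_inj) xE ltnn eqxx.
Qed.

(** * Paths in the symmetrized graph, and acyclicity *)

Definition G0_edge (x y : cantor_space) : bool := `[< symcl G0 (x, y) >].

(** To change bit [n], walk until the first [n] bits form [sn n], cross the edge flipping bit [n],
    then walk on to [y]; both walks come from induction. *)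
Lemma G0_path n (x y : cantor_space) : (forall i, (n <= i)%N -> x i = y i) ->
  exists2 p, path G0_edge x p & last x p = y.
Proof.
elim: n x y => [|n IH] x y xy.
  by exists [::] => //; apply/funext => i; exact: xy.
have [xyn|xyn] := eqVneq (x n) (y n).
  apply: IH => i; rewrite leq_eqVlt => /orP[/eqP<- //|]; exact: xy.
pose gamma : cantor_space := fun i => x (i + n.+1)%N.
pose z e := catw (rcons (sn n) e) gamma.
have zE (t : cantor_space) : (forall i, (n < i)%N -> t i = x i) ->
    forall i, (n <= i)%N -> z (t n) i = t i.
  move=> tx i; rewrite /z /catw size_rcons size_sn nth_rcons size_sn ltnS.
  by case: ltngtP => // [ni _|-> //]; rewrite /gamma subnK // tx.
have [p px pz] : exists2 p, path G0_edge x p & last x p = z (x n).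
  by apply: IH => i ni; rewrite zE.
have [q qz qy] : exists2 q, path G0_edge (z (y n)) q & last (z (y n)) q = y.
  by apply: IH => i ni; apply: zE => // k nk; rewrite xy.
exists (p ++ z (y n) :: q); last by rewrite last_cat /= qy.
rewrite cat_path px /= pz qz andbT; apply/asboolP.
case: (x n) (y n) xyn => [] [] // _; [right|left]; by exists n, gamma.
Qed.

(** Take a repetition-free path from [x] to [y]. Length 0 contradicts irreflexivity, length 1 is the
    claim, and a longer path is closed into a cycle by [(f x, f y)]. *)
Lemma acyclic_spread_edge (S : set (cantor_space * cantor_space))
    (f : cantor_space -> cantor_space) n (x y : cantor_space) :
  digraph S -> Acyclic S -> injective f ->
  (forall u v, G0 (u, v) -> S (f u, f v)) ->
  (forall i, (n <= i)%N -> x i = y i) -> S (f x, f y) -> symcl G0 (x, y).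
Proof.
move=> dS aS finj fS /G0_path[p px pl].
have {}fS u v : G0_edge u v -> symcl S (f u, f v).
  by move/asboolP => [/fS|/fS]; [left|right].
move: pl; case/shortenP: px => p' p'x p'u _ <-.
case: p' p'x p'u => [|z [|z' p']] p'x p'u.
- by move/dS.
- by move=> _; move: p'x => /= /andP[/asboolP].
move=> Sxy; case: aS; set q := z :: z' :: p' in p'x p'u Sxy *.
exists (size q), (fun i => f (nth x (x :: q) i)); split => //.
- move=> i j iq jq /finj /eqP.
  by rewrite nth_uniq // => /eqP.
- by move=> i iq; apply: fS; exact: (pathP x p'x).
- by right; rewrite /= in Sxy *; rewrite nth_last.
Qed.

(** The two points of a pair in [G0] differ only at the bit following [sn n]. *)
Lemma symcl_G0_diff x y i j :
  symcl G0 (x, y) -> x i != y i -> x j != y j -> i = j.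
Proof.
have diff u v : G0 (u, v) -> exists n, forall k, u k != v k -> k = n.
  case=> n [gamma [-> ->]]; exists n => k.
  rewrite /catw !size_rcons size_sn !nth_rcons size_sn ltnS leq_eqVlt.
  by case: ltngtP; rewrite ?eqxx.
case=> /diff[n nP] xi xj; first by rewrite (nP i xi) (nP j xj).
by rewrite eq_sym in xi; rewrite eq_sym in xj; rewrite (nP i xi) (nP j xj).
Qed.

Theorem theorem2p6 (S : set (cantor_space * cantor_space)) :
  digraph S -> Fsigma S -> Acyclic S -> G0 `<=` S ->
  exists f : cantor_space -> cantor_space,
    [/\ injective f,
        continuous f,
        G0 `<=` prodmap f @^-1` G0,
        prodmap f @^-1` G0 `<=` prodmap f @^-1` S
      & prodmap f @^-1` S `<=` symcl G0].
Proof.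
move=> dS [F cF SE] aS G0S.
have [m mP] := course_of_values_choice (good_next F) (@good_next_local F)
  (fun m n => good_next_exists F m n cF).
have m_homo : {homo m : i j / (i < j)%N}.
  by move=> i j; case: (mP j) => + _ _; apply.
have m_inj := incn_inj (leq_mono m_homo).
have fG0 : G0 `<=` prodmap (spread m) @^-1` G0.
  by apply: spread_G0 => // n; case: (mP n).
exists (spread m); split=> //.
- exact: spread_inj.
- exact: spread_continuous.
- by move=> xy /G0S.
move=> [x y] Sxy; have {}Sxy : S (spread m x, spread m y) by [].
have edge n u v := acyclic_spread_edge S (spread m) n u v dS aS
  (spread_inj m m_inj) (fun u v uv => G0S _ (fG0 (u, v) uv)).
have [[n xyn]|noN] := pselect (exists n, forall i, (n <= i)%N -> x i = y i).
  exact: edge xyn Sxy.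
have diff n : exists2 i, (n <= i)%N & x i != y i.
  apply: contrapT => h; apply: noN; exists n => i ni.
  by apply/eqP; apply: contra_notT h => xyi; exists i.
have [i0 _ xy0] := diff 0%N; have [i1 i01 xy1] := diff i0.+1.
move: (Sxy); rewrite {1}SE => -[k _ Fk]; exfalso.
(* [n >= k] makes [F k] one of the sets handled at stage [n]; [n > i1] keeps both differences
   [i0 < i1] in the truncations. *)
pose n := maxn k i1.+1.
have i1n : (i1 < n)%N by exact: leq_maxr.
have i0n : (i0 < n)%N by exact: ltn_trans i1n.
have [_ _ /(_ k x y _ _ (leq_maxl _ _)) mn] := mP n.
apply: (mn (spread m x) (spread m y)) Fk.
(* The truncations agree from [n] on, so membership in [F k] would make them an edge, yet they
   differ at two places. *)
- move=> Fn.
  have : S (spread m (trunc n x), spread m (trunc n y)) by rewrite SE; exists k.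
  move/(edge n) => /(_ _)/symcl_G0_diff h.
  have : i0 = i1.
    by apply: h => [i ni||]; rewrite /trunc ?i0n ?i1n // ltnNge ni.
  by move=> i01E; rewrite i01E ltnn in i01.
- by move=> i; exact: spread_trunc.
- by move=> i; exact: spread_trunc.
Qed.
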